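(* Let $\varphi$ be a function in the Laguerre-P\'olya class which either has order $\rho<2$, or has order $\rho=2$ and minimal type. Suppose $\mu_\infty(\varphi)\ge 1$. Then for all $x\in\mathbb{R}$, $$[\varphi(x+1)-\varphi(x-1)]^2 - 4\varphi(x)\,[\varphi(x+1)-2\varphi(x)+\varphi(x-1)] \ge 0 .$$
   Context: A real entire function $\varphi$ belongs to the Laguerre-P\'olya class if it can be expressed in the form $$\varphi(x)=c\,x^m e^{-ax^2+bx}\prod_{k=1}^{\omega}\left(1+\frac{x}{x_k}\right)e^{-x/x_k}\qquad(0\le\omega\le\infty),$$ where $b,c,x_k\in\mathbb{R}$, $m$ is a non-negative integer, $a\ge 0$, $x_k\ne 0$, and $\sum_{k=1}^{\omega}x_k^{-2}<\infty$. For such $\varphi$ with zeros $\{\alpha_i\}$, listed with multiplicity, the mesh size is $\mu_\infty(\varphi):=\inf_{i\ne j}|\alpha_i-\alpha_j|$ (so $\mu_\infty(\varphi)\ge1$ forces the zeros to be simple; the condition is vacuous if $\varphi$ has at most one zero). ''Order'' and ''(minimal) type'' are the usual growth order and type of an entire function; minimal type means type $0$. *)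

(* Defs.v *)
From HB Require Import structures.
From mathcomp Require Import all_boot all_order all_algebra.
From mathcomp Require Import complex.
From mathcomp Require Import all_classical all_reals all_analysis.

Set Implicit Arguments.
Unset Strict Implicit.
Unset Printing Implicit Defensive.

Import Order.TTheory GRing.Theory Num.Theory numFieldNormedType.Exports.

Local Open Scope classical_set_scope.
Local Open Scope ring_scope.
Local Open Scope complex_scope.

(* exp (u + i v) = e^u (cos v + i sin v) *)
Definition cexp (R : realType) (z : R[i]) : R[i] :=
  (expR (complex.Re z) * cos (complex.Im z))
    +i* (expR (complex.Re z) * sin (complex.Im z)).

Definition entire (R : realType) (phi : R[i] -> R[i]) : Prop :=
  forall z : R[i], derivable (phi : R[i]^o -> R[i]^o) z 1.

Definition real_entire (R : realType) (phi : R[i] -> R[i]) : Prop :=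
  entire phi /\ forall x : R, complex.Im (phi x%:C) = 0.

(* [omega : option nat] is a length in {0, 1, ..., oo}, [None] being oo. *)
Definition below (omega : option nat) (k : nat) : bool :=
  if omega is Some n then (k < n)%N else true.

(* The factors are indexed from 0 (k < omega) instead of from 1 (k <= omega);
   [x k] is irrelevant when [below omega k] is false. *)
Definition laguerre_polya (R : realType) (phi : R[i] -> R[i]) : Prop :=
  real_entire phi /\
  exists (m : nat) (a b c : R) (omega : option nat) (x : nat -> R)
         (P : R[i] -> R[i]),
  [/\ 0 <= a,
      forall k, below omega k -> x k != 0,
      (\sum_(0 <= k <oo | below omega k) (x k ^- 2)%:E < +oo)%E,
      forall z : R[i],
        (\prod_(0 <= k < n | below omega k)
           ((1 + z / (x k)%:C) * cexp (- z / (x k)%:C)) : R[i]^o)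
          @[n --> \oo] --> (P z : R[i]^o)
    & forall z : R[i],
        phi z = c%:C * z ^+ m * cexp (- a%:C * z ^+ 2 + b%:C * z) * P z].

(* An enumeration-free listing of the zeros with multiplicity: a zero alpha of
   multiplicity d is listed as (alpha, 0), ..., (alpha, d - 1). *)
Definition zeros (R : realType) (phi : R[i] -> R[i]) : set (R[i] * nat) :=
  [set p | forall j : nat, (j <= p.2)%N ->
     derive1n j (phi : R[i]^o -> R[i]^o) p.1 = 0].

(* The infimum is taken in the extended reals, so that it is +oo when there is
   at most one zero. *)
Definition mesh (R : realType) (phi : R[i] -> R[i]) : \bar R :=
  ereal_inf [set d : \bar R | exists p q : R[i] * nat,
    [/\ zeros phi p, zeros phi q, p <> q & d = (Normc.normc (p.1 - q.1))%:E]].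

Definition max_modulus (R : realType) (phi : R[i] -> R[i]) (r : R) : R :=
  sup [set Normc.normc (phi z) | z in [set z : R[i] | Normc.normc z = r]].

(* Since [ln t = 0] for [t <= 0], this is 0 for constant functions,
   the zero function included. *)
Definition growth_order (R : realType) (phi : R[i] -> R[i]) : \bar R :=
  limf_esup (fun r : R => (ln (ln (max_modulus phi r)) / ln r)%:E)
    (pinfty_nbhs R).

Definition growth_type (R : realType) (rho : R) (phi : R[i] -> R[i]) : \bar R :=
  limf_esup (fun r : R => (ln (max_modulus phi r) / r `^ rho)%:E)
    (pinfty_nbhs R).

(* Main.v *)
(* Put p = phi x, y = phi (x + 1), q = phi (x - 1).  The expression equals
   (y + q - 2 p)^2 + 4 (p^2 - y q), and also (y - q)^2 - 4 p (y - 2 p + q), so it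
   is nonnegative if y q <= p^2, or if both p y <= 0 and p q <= 0.  By taking
   limits it suffices to treat exp (- a x^2 + b x) times a finite product of
   factors x - alpha whose zeros alpha are at mutual distance at least 1.  At
   most two zeros then lie in ]x - 1, x + 1[.  If there is none, each factor
   (x - alpha)^2 - 1 of y q is between 0 and (x - alpha)^2, so y q <= p^2; if
   there is one, y q <= 0; if there are two, they enclose x, so p y <= 0 and
   p q <= 0.  (The Gaussian factor only decreases |y q| / p^2 since a >= 0, so
   the growth of phi plays no role.)

   That the mesh condition separates the parameters of the product requires
   that a repeated parameter yields a multiple zero of phi: the bound
   |(1 + t) exp (- t)| <= exp (t^2) and the convergence of the sum of the
   x_k^-2 make the other factors locally bounded, so phi vanishes
   quadratically. *)
Require Import Defs.
From HB Require Import structures.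
From mathcomp Require Import all_boot all_order all_algebra.
From mathcomp Require Import complex.
From mathcomp Require Import all_classical all_reals all_analysis.
From mathcomp Require Import ring lra.
Import Order.TTheory GRing.Theory Num.Theory numFieldNormedType.Exports.
Local Open Scope classical_set_scope.
Local Open Scope ring_scope.
Local Open Scope complex_scope.

(** * The three-point inequality for finite products with separated real zeros *)

Lemma discrete_laguerre_criterion {R : realDomainType} (p q y : R) :
  y * q <= p ^+ 2 \/ (p * y <= 0 /\ p * q <= 0) ->
  0 <= (y - q) ^+ 2 - 4%:R * p * (y - 2%:R * p + q).
Proof.
case=> [h|[h1 h2]].
  have -> : (y - q) ^+ 2 - 4%:R * p * (y - 2%:R * p + q) =
    (y + q - 2%:R * p) ^+ 2 + 4%:R * (p ^+ 2 - y * q) by ring.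
  by rewrite addr_ge0 ?sqr_ge0 // mulr_ge0 // subr_ge0.
have -> : (y - q) ^+ 2 - 4%:R * p * (y - 2%:R * p + q) =
  (y - q) ^+ 2 + 4%:R * (2%:R * p ^+ 2 - p * y - p * q) by ring.
rewrite addr_ge0 ?sqr_ge0 // mulr_ge0 //.
have := sqr_ge0 p; lra.
Qed.

Definition monic_prod {R : realFieldType} (s : seq R) (x : R) : R :=
  \prod_(a <- s) (x - a).

Lemma far_prod_le {R : realFieldType} (s : seq R) (x : R) :
  all (fun a => 1 <= `|x - a|) s ->
  0 <= monic_prod s (x + 1) * monic_prod s (x - 1) <= monic_prod s x ^+ 2.
Proof.
move=> /allP far; rewrite /monic_prod -big_split -prodrXl /= !big_seq.
have far2 a : a \in s -> 1 <= (x - a) ^+ 2.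
  by move=> /far h; rewrite -[_ ^+ 2]real_normK ?num_real // expr_ge1.
apply/andP; split.
  by rewrite prodr_ge0 // => a /far2 h; nra.
by rewrite ler_prod // => a /far2 h; apply/andP; split; nra.
Qed.

(** A unit step cannot cross a point at distance at least 1: it changes [(x - a) ^+ 2] by
    [(x - a) * e], which is no larger in absolute value. *)
Lemma far_prod_step {R : realFieldType} (s : seq R) (x e : R) :
  `|e| = 1 -> all (fun a => 1 <= `|x - a|) s ->
  0 <= monic_prod s x * monic_prod s (x + e).
Proof.
move=> he /allP far; rewrite /monic_prod -big_split /= big_seq prodr_ge0 // => a /far h.
have : `|(x - a) * e| <= (x - a) ^+ 2.
  by rewrite normrM he mulr1 -[_ ^+ 2]real_normK ?num_real // ler_eXnr.
rewrite ler_norml; nra.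
Qed.

(* Left: at most one zero in ]x - 1, x + 1[.  Right: exactly two. *)
Lemma separated_prod_criterion {R : realFieldType} (s : seq R) (x : R) :
  pairwise (fun a b => 1 <= `|a - b|) s ->
  monic_prod s (x + 1) * monic_prod s (x - 1) <= monic_prod s x ^+ 2 \/
  (monic_prod s x * monic_prod s (x + 1) <= 0 /\
   monic_prod s x * monic_prod s (x - 1) <= 0).
Proof.
move=> sep; pose far a := 1 <= `|x - a|.
have split_near z : monic_prod s z =
    monic_prod [seq a <- s | ~~ far a] z * monic_prod [seq a <- s | far a] z.
  rewrite mulrC /monic_prod -big_cat; apply: perm_big.
  by rewrite perm_sym; apply/permPl/(perm_filterC far).
rewrite !split_near.
have all_far : all far [seq a <- s | far a] by apply: filter_all.
have : all (fun a => ~~ far a) [seq a <- s | ~~ far a] by apply: filter_all.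
have := pairwise_filter (fun a => ~~ far a) sep.
have /andP[] := far_prod_le _ _ all_far.
have := far_prod_step _ _ _ (normr1 _) all_far.
have := far_prod_step _ _ _ (normrN1 _) all_far.
set F0 := monic_prod _ x; set F1 := monic_prod _ (x + 1).
set F2 := monic_prod _ (x - 1).
move=> F02 F01 F12 F00 {split_near all_far}.
case: [seq a <- s | ~~ far a] => [|a [|b [|d t]]].
- by move=> _ _; left; rewrite /monic_prod !big_nil !mul1r.
- move=> _; rewrite /= andbT -ltNge ltr_norml => /andP[ha1 ha2].
  left; rewrite /monic_prod !big_seq1.
  have -> : (x + 1 - a) * F1 * ((x - 1 - a) * F2) =
            - ((1 - (x - a) ^+ 2) * (F1 * F2)) by ring.
  apply: (@le_trans _ _ 0); last exact: sqr_ge0.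
  by rewrite oppr_le0 mulr_ge0 //; nra.
- rewrite /= !andbT => hab /andP[]; rewrite /far -!ltNge !ltr_norml.
  move=> /andP[ha1 ha2] /andP[hb1 hb2].
  (* Both points are within 1 of [x] and at least 1 apart, so [x] lies between them. *)
  have hab0 : (x - a) * (x - b) <= 0.
    move: hab; rewrite ler_normr => /orP[] ?; last rewrite mulrC.
      by rewrite mulr_le0_ge0 //; lra.
    by rewrite mulr_le0_ge0 //; lra.
  right; rewrite /monic_prod !big_cons !big_nil !mulr1; split.
  + have -> : (x - a) * (x - b) * F0 * ((x + 1 - a) * (x + 1 - b) * F1) =
      (x - a) * (x - b) * ((x + 1 - a) * (x + 1 - b) * (F0 * F1)) by ring.
    by rewrite mulr_le0_ge0 // mulr_ge0 // mulr_ge0 //; lra.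
  + have -> : (x - a) * (x - b) * F0 * ((x - 1 - a) * (x - 1 - b) * F2) =
      (x - a) * (x - b) * ((a + 1 - x) * (b + 1 - x) * (F0 * F2)) by ring.
    by rewrite mulr_le0_ge0 // mulr_ge0 // mulr_ge0 //; lra.
(* Three points at mutual distances at least 1 span at least 2, too much for an open interval of
   length 2. *)
- rewrite /= => /andP[/and3P[hab had _] /andP[/andP[hbd _] _]].
  move=> /and4P[]; rewrite /far -!ltNge !ltr_norml.
  move=> /andP[ha1 ha2] /andP[hb1 hb2] /andP[hd1 hd2] _; exfalso.
  move: hab had hbd; rewrite !ler_normr => /orP[] ? /orP[] ? /orP[] ?; lra.
Qed.

(** * Complex modulus, limits and derivatives along the real line *)

Lemma normcR {R : realType} (x : R) : Normc.normc x%:C = `|x|.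
Proof. by rewrite /Normc.normc /= expr0n /= addr0 sqrtr_sqr. Qed.

Lemma normc_ge0 {R : realType} (z : R[i]) : 0 <= Normc.normc z.
Proof. by case: z => a b; rewrite sqrtr_ge0. Qed.

Lemma normc_ge_absIm {R : realType} (z : R[i]) : `|complex.Im z| <= Normc.normc z.
Proof.
by case: z => a b /=; rewrite -sqrtr_sqr ler_wsqrtr // lerDr sqr_ge0.
Qed.

Lemma normc_ge_absRe {R : realType} (z : R[i]) : `|complex.Re z| <= Normc.normc z.
Proof.
by case: z => a b /=; rewrite -sqrtr_sqr ler_wsqrtr // lerDl sqr_ge0.
Qed.

(** The modulus dominates both parts; as [u n] is real, the imaginary part of [l] is dominated by
    the distance to [u n], hence by every [e > 0]. *)
Lemma cvg_real_complex {R : realType} (u : nat -> R) (l : R[i]) :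
  ((u n)%:C : R[i]^o) @[n --> \oo] --> (l : R[i]^o) ->
  u n @[n --> \oo] --> complex.Re l /\ complex.Im l = 0.
Proof.
move=> /cvgrPdist_lt ul.
have dist e : 0 < e -> \forall n \near \oo, Normc.normc (l - (u n)%:C) < e.
  move=> e0; have := ul e%:C; rewrite ltcR => /(_ e0).
  by apply: filterS => n; rewrite -ltcR.
split.
  apply/cvgrPdist_lt => e /dist; apply: filterS => n; apply: le_lt_trans.
  by have := normc_ge_absRe (l - (u n)%:C); rewrite raddfB.
apply/eqP; rewrite -normr_le0; apply/ler_addgt0Pr => e /dist [N _ /(_ N (leqnn N))] /=.
move=> /ltW; rewrite add0r; apply: le_trans.
by have := normc_ge_absIm (l - (u N)%:C); rewrite raddfB /= subr0.
Qed.

Lemma derivable_dist_lt {K : numFieldType} {f : K^o -> K^o} {a eps : K} :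
  derivable f a 1 -> 0 < eps -> exists2 r : K, 0 < r &
    forall h : K, h != 0 -> `|h| < r ->
      `|('D_1 f a : K) - h^-1 * (f (h + a) - f a)| < eps.
Proof.
move=> /cvg_ex[l fl] eps0.
have -> : 'D_1 f a = l by apply/cvg_lim.
move/cvgrPdist_lt: fl => /(_ _ eps0)/nbhs_ballP[r /= r0 rball].
exists r => // h h0 hr; have := rball h; rewrite -ball_normE /= sub0r normrN.
by move=> /(_ hr h0); rewrite [_%:A]mulr1.
Qed.

(** The difference quotient at a real [t] is at most [M * t] for [t > 0]. As the complex derivative
    exists, small real increments already determine it. *)
Lemma derive1_eq0_quadratic {R : realType} (phi : R[i] -> R[i]) (x0 M : R) :
  derivable (phi : R[i]^o -> R[i]^o) x0%:C 1 ->
  (forall t : R, `|t| <= 1 -> Normc.normc (phi (t + x0)%:C) <= M * t ^+ 2) ->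
  phi x0%:C = 0 /\ derive1 (phi : R[i]^o -> R[i]^o) x0%:C = 0.
Proof.
move=> dphi small.
have phi0 : phi x0%:C = 0.
  apply: Normc.eq0_normc; apply/eqP; rewrite eq_le normc_ge0 andbT.
  by have := small 0; rewrite normr0 ler01 expr0n mulr0 add0r; apply.
split=> //.
rewrite derive1E; set d := LHS.
apply: Normc.eq0_normc; apply/eqP; rewrite eq_le normc_ge0 andbT.
apply/ler_addgt0Pr => e e0; rewrite add0r.
have e20 : 0 < e / 2 by rewrite divr_gt0.
have := derivable_dist_lt dphi (_ : 0 < (e / 2)%:C); rewrite ltcR => /(_ e20).
move=> [r r0 rball].
(* In the order of [R[i]], a positive number is real. *)
have [rr r'0] : r = (complex.Re r)%:C /\ 0 < complex.Re r.
  by move: r0 {rball}; case: r => a b; rewrite ltcE /= => /andP[/eqP -> ->].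
(* The three bounds put [t] in the range of [small], put it inside the ball, and make the quotient
   at most [e / 2]; adding 1 keeps the divisor nonzero. *)
pose t := Num.min 1 (Num.min (complex.Re r / 2) (e / 2 / (`|M| + 1))).
have M0 : 0 < `|M| + 1 by rewrite ltr_wpDl.
have t0 : 0 < t by rewrite !lt_min ltr01 !divr_gt0.
have t1 : t <= 1 by rewrite ge_min lexx.
have tr : t < complex.Re r.
  apply: (@le_lt_trans _ _ (complex.Re r / 2)); last by lra.
  by rewrite !ge_min lexx orbT.
have te : (`|M| + 1) * t <= e / 2.
  by rewrite mulrC -ler_pdivlMr // !ge_min lexx !orbT.
have tC0 : t%:C != 0 :> R[i] by rewrite -[0]/(0%:C) (inj_eq (@complexI R)) gt_eqF.
have := rball _ tC0; rewrite {1}rr -[`|_|]/((Normc.normc _)%:C) ltcR normcR gtr0_norm //.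
move=> /(_ tr); rewrite -[`|_|]/((Normc.normc _)%:C) ltcR phi0 subr0 => dt.
have st : Normc.normc (t%:C^-1 * phi (t + x0)%:C) <= e / 2.
  rewrite Normc.normcM Normc.normcV normcR gtr0_norm // ler_pdivrMl //.
  apply: le_trans (small t _) _; first by rewrite gtr0_norm.
  apply: le_trans (_ : t * ((`|M| + 1) * t) <= _); last by rewrite ler_pM2l.
  have := ler_norm M; have := ltW t0; nra.
rewrite -[d](subrK (t%:C^-1 * phi (t + x0)%:C)).
apply: le_trans (le_normcD _ _) _.
have -> : e = e / 2 + e / 2 by lra.
by rewrite lerD //; move/ltW: dt; rewrite -rmorphD.
Qed.

(** * Truncated products on the real line, and bounds uniform in the truncation *)

(* For t < -1, put s = -t and use s - 1 <= 1 + (s^2 - s) <= exp (s^2 - s). *)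
Lemma canonical_factor_le {R : realType} (t : R) :
  `|(1 + t) * expR (- t)| <= expR (t ^+ 2).
Proof.
rewrite normrM (gtr0_norm (expR_gt0 _)) expRN ler_pdivrMr ?expR_gt0 // -expRD.
rewrite ler_norml; apply/andP; split.
  by have := expR_ge1Dx (t ^+ 2 + t); nra.
have := expR_ge1Dx (t ^+ 2 + t); have := sqr_ge0 t; nra.
Qed.

Definition lp_factor {R : realType} (x : nat -> R) (k : nat) (t : R) : R :=
  (1 + t / x k) * expR (- t / x k).

Definition lp_partial {R : realType} (m : nat) (a b c : R) (omega : option nat)
    (x : nat -> R) (n : nat) (t : R) : R :=
  c * t ^+ m * expR (- a * t ^+ 2 + b * t) *
  \prod_(0 <= k < n | below omega k) lp_factor x k t.

Lemma cexpR {R : realType} (t : R) : cexp t%:C = (expR t)%:C.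
Proof. by rewrite /cexp /= cos0 sin0 mulr1 mulr0. Qed.

Lemma lp_factorC {R : realType} (x : nat -> R) (k : nat) (t : R) :
  (1 + t%:C / (x k)%:C) * cexp (- t%:C / (x k)%:C) = (lp_factor x k t)%:C.
Proof. by rewrite -fmorphV -rmorphN -!rmorphM cexpR -[1]/(1%:C) -rmorphD -rmorphM. Qed.

(** Pointwise convergence on the real line suffices later: the quadratic bounds and the final
    inequality both pass to such limits. *)
Lemma lp_partial_cvg {R : realType} (phi P : R[i] -> R[i])
    (m : nat) (a b c : R) (omega : option nat) (x : nat -> R) (t : R) :
  (forall z : R[i],
    (\prod_(0 <= k < n | below omega k)
       ((1 + z / (x k)%:C) * cexp (- z / (x k)%:C)) : R[i]^o)
      @[n --> \oo] --> (P z : R[i]^o)) ->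
  (forall z : R[i],
    phi z = c%:C * z ^+ m * cexp (- a%:C * z ^+ 2 + b%:C * z) * P z) ->
  lp_partial m a b c omega x n t @[n --> \oo] --> complex.Re (phi t%:C).
Proof.
move=> Pcvg phiE.
have : ((\prod_(0 <= k < n | below omega k) lp_factor x k t)%:C : R[i]^o)
   @[n --> \oo] --> (P t%:C : R[i]^o).
  have := Pcvg t%:C.
  suff -> : (fun n => (\prod_(0 <= k < n | below omega k)
         ((1 + t%:C / (x k)%:C) * cexp (- t%:C / (x k)%:C)) : R[i]^o)) =
      (fun n => ((\prod_(0 <= k < n | below omega k) lp_factor x k t)%:C
         : R[i]^o)) by [].
  apply/funext => n; rewrite rmorph_prod; apply: eq_bigr => k _.
  exact: lp_factorC.
move=> /cvg_real_complex[Pre Pim].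
have -> : complex.Re (phi t%:C) =
    c * t ^+ m * expR (- a * t ^+ 2 + b * t) * complex.Re (P t%:C).
  rewrite phiE -!(rmorphXn, rmorphN, rmorphM, rmorphD) cexpR -rmorphM.
  by case: (P t%:C) => u v /=; rewrite mul0r subr0.
by apply: cvgM; [exact: cvg_cst|exact: Pre].
Qed.

Lemma lp_factor_prod_le {R : realType} (x : nat -> R) (s : seq nat) (t : R) :
  `|\prod_(k <- s) lp_factor x k t| <= expR (t ^+ 2 * \sum_(k <- s) x k ^- 2).
Proof.
rewrite normr_prod mulr_sumr expR_sum; apply: ler_prod => k _; rewrite normr_ge0 /=.
by rewrite /lp_factor mulNr -exprVn -exprMn canonical_factor_le.
Qed.

Lemma lp_prefactor_le {R : realType} (m : nat) (a b c B t : R) :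
  0 <= a -> `|t| <= B ->
  `|c * t ^+ m * expR (- a * t ^+ 2 + b * t)| <= `|c| * `|t| ^+ m * expR (`|b| * B).
Proof.
move=> a0 tB; rewrite !normrM normrX (gtr0_norm (expR_gt0 _)).
rewrite ler_wpM2l ?mulr_ge0 ?exprn_ge0 // ler_expR.
have : b * t <= `|b| * B.
  by apply: le_trans (ler_norm _) _; rewrite normrM ler_wpM2l.
have := mulr_ge0 a0 (sqr_ge0 t); lra.
Qed.

Definition lp_indices (omega : option nat) (n : nat) : seq nat :=
  [seq k <- index_iota 0 n | below omega k].

Lemma lp_partialE {R : realType} m (a b c : R) omega x n t :
  lp_partial m a b c omega x n t =
  c * t ^+ m * expR (- a * t ^+ 2 + b * t) *
  \prod_(k <- lp_indices omega n) lp_factor x k t.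
Proof. by rewrite /lp_partial big_filter. Qed.

Lemma lp_partial_zero_quadratic {R : realType} m (a b c S : R) omega x :
  0 <= a -> (2 <= m)%N ->
  (forall n, \sum_(k <- lp_indices omega n) x k ^- 2 <= S) ->
  exists M, forall n t, `|t| <= 1 ->
    `|lp_partial m a b c omega x n t| <= M * t ^+ 2.
Proof.
move=> a0 m2 leS; exists (`|c| * expR (`|b| * 1) * expR S) => n t t1.
rewrite lp_partialE normrM.
have t2 : t ^+ 2 <= 1 by rewrite -[_ ^+ 2]real_normK ?num_real // expr_le1.
have -> : `|c| * expR (`|b| * 1) * expR S * t ^+ 2 =
  `|c| * t ^+ 2 * expR (`|b| * 1) * expR S by ring.
apply: ler_pM => //.
  apply: le_trans (lp_prefactor_le _ _ _ _ _ _ a0 t1) _.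
  rewrite ler_wpM2r ?expR_ge0 // ler_wpM2l // -[leRHS]real_normK ?num_real //.
  by rewrite ler_wiXn2l.
apply: le_trans (lp_factor_prod_le _ _ _) _; rewrite ler_expR.
apply: le_trans (leS n).
by rewrite ler_piMl // sumr_ge0 // => k _; rewrite invr_ge0 sqr_ge0.
Qed.

(** At [t - x i] the factors [i] and [j] each contribute a factor [t]. Taking [n] beyond both
    indices ensures that both occur; [M] is independent of [n], so the bound survives the limit. *)
Lemma lp_partial_double_quadratic {R : realType} m (a b c S : R) omega x i j :
  0 <= a -> i != j -> below omega i -> below omega j ->
  x i != 0 -> x i = x j ->
  (forall n, \sum_(k <- lp_indices omega n) x k ^- 2 <= S) ->
  exists M, forall n t, (maxn i j < n)%N -> `|t| <= 1 ->
    `|lp_partial m a b c omega x n (t - x i)| <= M * t ^+ 2.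
Proof.
move=> a0 ij bi bj; set y := x i => y0 yj leS.
set B := 1 + `|y|.
(* Since [B] bounds the modulus of [t - y], these terms bound in turn the prefactor, the two equal
   factors divided by [t], and all the other factors. *)
exists (`|c| * B ^+ m * expR (`|b| * B) *
  ((expR (B / `|y|) / y) ^+ 2 * expR (B ^+ 2 * S))) => n t.
rewrite gtn_max => /andP[ni nj] t1.
have tB : `|t - y| <= B by rewrite (le_trans (ler_normB _ _)) // lerD2r.
have B0 : 0 <= B by apply: le_trans tB.
have Is : i \in lp_indices omega n by rewrite mem_filter bi mem_index_iota.
have Js : j \in rem i (lp_indices omega n).
  by apply: rem_mem; rewrite 1?eq_sym // mem_filter bj mem_index_iota.
rewrite lp_partialE (big_rem _ Is) /= (big_rem _ Js) /=.
set s := rem j _.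
have sumE : \sum_(k <- s) x k ^- 2 <= S.
  apply: le_trans (leS n); rewrite (big_rem _ Is) /= (big_rem _ Js) /=.
  by rewrite addrA lerDr addr_ge0 // invr_ge0 sqr_ge0.
have -> : lp_factor x j (t - y) = lp_factor x i (t - y) by rewrite /lp_factor -yj.
rewrite [X in _ * X]mulrA -expr2 normrM.
set K := `|c| * B ^+ m * _; set G := expR (B / _) / y; set E := expR (_ * S).
have -> : K * (G ^+ 2 * E) * t ^+ 2 = K * ((G * t) ^+ 2 * E) by ring.
apply: ler_pM => //.
  apply: le_trans (lp_prefactor_le _ _ _ _ _ _ a0 tB) _.
  by rewrite ler_wpM2r ?expR_ge0 // ler_wpM2l // lerXn2r ?nnegrE.
rewrite normrM; apply: ler_pM => //.
  have -> : lp_factor x i (t - y) = expR (- (t - y) / y) / y * t.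
    by rewrite /lp_factor -/y; field.
  rewrite normrX -[leRHS]real_normK ?num_real // lerXn2r ?nnegrE //.
  rewrite !normrM ler_wpM2r // ler_wpM2r // !(gtr0_norm (expR_gt0 _)) ler_expR.
  by rewrite (le_trans (ler_norm _)) // normrM normrN normfV ler_wpM2r.
apply: le_trans (lp_factor_prod_le _ _ _) _; rewrite ler_expR ler_pM ?sqr_ge0 //.
  by rewrite sumr_ge0 // => k _; rewrite invr_ge0 sqr_ge0.
by rewrite -[leLHS]real_normK ?num_real // lerXn2r ?nnegrE // (le_trans _ tB).
Qed.

(** * Consequences of the mesh condition *)

Lemma mesh_ge1 {R : realType} (phi : R[i] -> R[i]) (p q : R[i] * nat) :
  (1%:E <= mesh phi)%E -> zeros phi p -> zeros phi q -> p <> q ->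
  1 <= Normc.normc (p.1 - q.1).
Proof.
move=> mesh1 zp zq pq; rewrite -lee_fin (le_trans mesh1) //.
by apply: ereal_inf_lbound; exists p, q.
Qed.

Lemma zeros_root {R : realType} (phi : R[i] -> R[i]) (z : R[i]) :
  phi z = 0 -> zeros phi (z, 0%N).
Proof. by move=> z0 j /=; rewrite leqn0 => /eqP ->. Qed.

Lemma mesh_real_zeros {R : realType} (phi : R[i] -> R[i]) (s t : R) :
  (1%:E <= mesh phi)%E -> phi s%:C = 0 -> phi t%:C = 0 -> s != t ->
  1 <= `|s - t|.
Proof.
move=> mesh1 /zeros_root zs /zeros_root zt st.
rewrite -normcR rmorphB; apply: (mesh_ge1 _ _ _ mesh1 zs zt).
by move=> [] /eqP; rewrite (negbTE st).
Qed.

(** A double zero is listed in [zeros] as two distinct pairs over the same point, at distance 0. *)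
Lemma mesh_no_double_zero {R : realType} (phi : R[i] -> R[i]) (x0 M : R) :
  (1%:E <= mesh phi)%E -> entire phi ->
  ~ (forall t : R, `|t| <= 1 -> Normc.normc (phi (t + x0)%:C) <= M * t ^+ 2).
Proof.
move=> mesh1 ephi /(derive1_eq0_quadratic _ _ _ (ephi _))[phi0 dphi0].
have z1 : zeros phi (x0%:C, 1%N) by case=> [|[|]].
have ne : (x0%:C, 0%N) <> (x0%:C, 1%N) by [].
have := mesh_ge1 _ _ _ mesh1 (zeros_root _ _ phi0) z1 ne.
by rewrite subrr Normc.normc0 ler10.
Qed.

(** * The inequality for an exponential times a finite product *)

Lemma gaussian_monic_prod_ineq {R : realType} (a b c : R) (s : seq R) (t : R) :
  0 <= a -> pairwise (fun u v => 1 <= `|u - v|) s ->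
  let f u := c * expR (- a * u ^+ 2 + b * u) * monic_prod s u in
  0 <= (f (t + 1) - f (t - 1)) ^+ 2
       - 4%:R * f t * (f (t + 1) - 2%:R * f t + f (t - 1)).
Proof.
move=> a0 sep /=; apply: discrete_laguerre_criterion.
set w := - a * t ^+ 2 + b * t.
set w1 := - a * (t + 1) ^+ 2 + _; set w2 := - a * (t - 1) ^+ 2 + _.
(* The exponent has constant second difference: [w1 + w2 = 2 w - 2 a], the linear terms
   cancelling. *)
have ww : expR w1 * expR w2 = expR w ^+ 2 * expR (- a *+ 2).
  by rewrite expr2 -!expRD; congr expR; rewrite /w /w1 /w2; ring.
have e1 : expR (- a *+ 2) <= 1 by rewrite -expR0 ler_expR mulr2n; lra.
have e0 := expR_gt0 (- a *+ 2).
case: (separated_prod_criterion _ t sep) => [le|[le1 le2]]; [left|right].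
  have -> : c * expR w1 * monic_prod s (t + 1) * (c * expR w2 * monic_prod s (t - 1)) =
    c ^+ 2 * (expR w1 * expR w2) * (monic_prod s (t + 1) * monic_prod s (t - 1)) by ring.
  rewrite ww.
  set Q := _ * monic_prod s (t - 1).
  have -> : c ^+ 2 * (expR w ^+ 2 * expR (- a *+ 2)) * Q =
            (c * expR w) ^+ 2 * (expR (- a *+ 2) * Q) by ring.
  rewrite [leRHS]exprMn ler_wpM2l ?sqr_ge0 //.
  (* A factor at most 1 may increase a negative [Q], so in that case the comparison goes through
     0. *)
  have [Q0|Q0] := lerP 0 Q; first by apply: le_trans le; rewrite ler_piMl.
  by apply: le_trans (sqr_ge0 _); rewrite pmulr_rle0 // ltW.
have mulE u v : c * expR w * monic_prod s t * (c * u * v) =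
  c ^+ 2 * expR w * u * (monic_prod s t * v) by ring.
split; rewrite mulE mulr_ge0_le0 //.
  by rewrite (mulr_ge0 (mulr_ge0 (sqr_ge0 c) (expR_ge0 _)) (expR_ge0 _)).
by rewrite (mulr_ge0 (mulr_ge0 (sqr_ge0 c) (expR_ge0 _)) (expR_ge0 _)).
Qed.

(** Each factor is [(t + x k) / x k] times an exponential linear in [t], so the convergence factors
    merge into one, to be absorbed into [b]. *)
Lemma lp_factor_prodE {R : realType} (x : nat -> R) (s : seq nat) :
  {in s, forall k, x k != 0} ->
  exists C B, forall t, \prod_(k <- s) lp_factor x k t =
    C * expR (B * t) * monic_prod [seq - x k | k <- s] t.
Proof.
elim: s => [_|i s IHs nz].
  exists 1, 0 => t; rewrite /monic_prod !big_nil mul0r expR0; ring.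
have i0 : x i != 0 by apply: nz; rewrite inE eqxx.
have [k ks|C [B IH]] := IHs; first by apply: nz; rewrite inE ks orbT.
exists (C / x i), (B - (x i)^-1) => t.
rewrite /monic_prod /= !big_cons IH /monic_prod /lp_factor mulrBl expRD.
rewrite (_ : - t / x i = - ((x i)^-1 * t)); last by ring.
by field.
Qed.

Theorem theorem3p4 (R : realType) (phi : R[i] -> R[i])
  (hLP : laguerre_polya phi)
  (hgrowth : (growth_order phi < 2%:E)%E \/
             (growth_order phi = 2%:E /\ growth_type 2 phi = 0%:E))
  (hmesh : (1%:E <= mesh phi)%E) :
  forall x : R,
    0 <= (phi (x + 1)%:C - phi (x - 1)%:C) ^+ 2
         - 4%:R * phi x%:C
             * (phi (x + 1)%:C - 2%:R * phi x%:C + phi (x - 1)%:C).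
Proof.
move=> t; have {hgrowth} [[ephi phi_real] [m [a [b [c [omega [x [P H]]]]]]]] := hLP.
have {H} [a0 nz sumfin Pcvg phiE] := H.
pose f u := complex.Re (phi u%:C).
have phif u : phi u%:C = (f u)%:C.
  by rewrite /f; have := phi_real u; case: (phi _) => p q /= ->.
pose g n u := lp_partial m a b c omega x n u.
have gf u : g n u @[n --> \oo] --> f u by apply: lp_partial_cvg Pcvg phiE.
have [S leS] : exists S, forall n, \sum_(k <- lp_indices omega n) x k ^- 2 <= S.
  have sq_ge0 k : (0 <= (x k ^- 2)%:E)%E by rewrite lee_fin invr_ge0 sqr_ge0.
  exists (fine (\sum_(0 <= k <oo | below omega k) (x k ^- 2)%:E)%E) => n.
  rewrite big_filter -lee_fin fineK; last first.
    by rewrite ge0_fin_numE // nneseries_ge0.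
  by rewrite -sumEFin nneseries_lim_ge.
(* A quadratic bound uniform in [n] passes to [phi] and makes [x0] a double zero, which the mesh
   condition forbids. *)
have quadratic_limit x0 N M :
    (forall n u, (N < n)%N -> `|u| <= 1 -> `|g n (u + x0)| <= M * u ^+ 2) -> False.
  move=> leM; apply: (mesh_no_double_zero _ x0 M hmesh ephi) => u u1.
  rewrite phif normcR; apply: cvgr_to_le (cvg_norm (gf _)) _.
  by exists N.+1 => // n /= Nn; apply: leM.
have m1 : (m <= 1)%N.
  rewrite leqNgt; apply/negP => m2.
  have [M leM] := lp_partial_zero_quadratic m a b c S omega x a0 m2 leS.
  by apply: (quadratic_limit 0 0%N M) => n u _ u1; rewrite addr0 leM.
have xinj i j : below omega i -> below omega j -> i != j -> x i != x j.
  move=> bi bj ij; apply/eqP => xij.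
  have [M leM] := lp_partial_double_quadratic m a b c S omega x i j a0 ij bi bj
    (nz i bi) xij leS.
  by apply: (quadratic_limit (- x i) (maxn i j) M).
have root_phi u N : (forall n, (N < n)%N -> g n u = 0) -> phi u%:C = 0.
  move=> gu; rewrite phif (_ : f u = 0) //.
  apply: (@cvg_unique _ _ (g n u @[n --> \oo])) => //; first exact: gf.
  by apply: cvg_near_cst; exists N.+1 => // n /= Nn; apply: gu.
have phi_x i : below omega i -> phi (- x i)%:C = 0.
  move=> bi; apply: (root_phi _ i) => n ni; rewrite /g lp_partialE.
  have Is : i \in lp_indices omega n by rewrite mem_filter bi mem_index_iota.
  rewrite (big_rem _ Is) /=; have -> : lp_factor x i (- x i) = 0.
    by rewrite /lp_factor !mulNr divff ?nz // subrr mul0r.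
  by rewrite mul0r mulr0.
have phi_0 : (0 < m)%N -> phi 0%:C = 0.
  move=> m0; apply: (root_phi _ 0%N) => n _.
  by rewrite /g /lp_partial expr0n gtn_eqF // mulr0 !mul0r.
(* These are the zeros of [g n]. They are also zeros of [phi], and are distinct by [m1], [nz] and
   [xinj], so the mesh condition separates them. *)
have sep n : pairwise (fun u v : R => 1 <= `|u - v|)
    (nseq m 0 ++ [seq - x k | k <- lp_indices omega n]).
  rewrite pairwise_cat pairwise_map; apply/and3P; split.
  - apply/allrelP => u v /nseqP[-> m0] /mapP[k]; rewrite mem_filter => /andP[bk _] ->.
    apply: (mesh_real_zeros _ _ _ hmesh); [exact: phi_0|exact: phi_x|].
    by rewrite eq_sym oppr_eq0 nz.
  - by case: m m1 {g gf phiE root_phi phi_x phi_0 quadratic_limit} => [|[|]].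
  - have := filter_uniq (below omega) (iota_uniq 0 (n - 0)); rewrite uniq_pairwise.
    apply: (@sub_in_pairwise _ (below omega)); last exact: filter_all.
    move=> i j bi bj /= ij; apply: (mesh_real_zeros _ _ _ hmesh); [exact: phi_x..|].
    by rewrite eqr_opp xinj.
pose D h := (h (t + 1) - h (t - 1)) ^+ 2
  - 4%:R * h t * (h (t + 1) - 2%:R * h t + h (t - 1)) : R.
have Dg n : 0 <= D (g n).
  have [k|C [B prodE]] := lp_factor_prodE x (lp_indices omega n).
    by rewrite mem_filter => /andP[/nz].
  have gE : g n = fun u => (c * C) * expR (- a * u ^+ 2 + (b + B) * u) *
      monic_prod (nseq m 0 ++ [seq - x k | k <- lp_indices omega n]) u.
    apply/funext => u; rewrite /g lp_partialE prodE /monic_prod big_cat /=.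
    rewrite mulrDl addrA [expR (_ + _ + _)]expRD
      big_nseq subr0 -Monoid.iteropE -/(u ^+ m).
    by ring.
  by rewrite gE; apply: gaussian_monic_prod_ineq.
(* [D h] is a polynomial in three values of [h], so pointwise convergence is enough. *)
have Dgf : D (g n) @[n --> \oo] --> D f.
  have cst (r : R) : (fun=> r) @ \oo --> r by apply: cvg_cst.
  have d1 : (g n (t + 1) - g n (t - 1)) @[n --> \oo] --> f (t + 1) - f (t - 1).
    by apply: cvgB; exact: gf.
  have d2 : (g n (t + 1) - 2%:R * g n t + g n (t - 1)) @[n --> \oo] -->
      f (t + 1) - 2%:R * f t + f (t - 1).
    apply: cvgD; last exact: gf.
    by apply: cvgB; [exact: gf|apply: cvgM; [exact: cst|exact: gf]].
  apply: cvgB; first by apply: cvgM; exact: d1.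
  by apply: cvgM; [apply: cvgM; [exact: cst|exact: gf]|exact: d2].
have Df : 0 <= D f by apply: cvgr_to_ge Dgf _; apply: nearW.
rewrite !phif -(rmorph_nat (real_complex R) 4) -(rmorph_nat (real_complex R) 2).
by rewrite -!(rmorphM, rmorphB, rmorphD, rmorphXn) -[0]/(0%:C) lecR.
Qed.
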